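(* Let $(W_n)_{n\in\mathbb{Z}}$ be a stationary reversible Markov chain with Polish state space $\mathcal{W}$, transition function $Q$ and marginal distribution $\pi$. Let $g\in L_0^2(\pi)$, $X_k=g(W_k)$, $S_n=X_1+\cdots+X_n$, $\sigma_n^2=E(S_n^2)$, and define $\ell(n)=\sigma_n^2/n$ for $n\ge 1$. (i) If $\liminf_{n\to\infty}\ell(n)<\infty$, then there is a $\kappa\in[0,\infty)$ such that $\lim_{n\to\infty}\sigma_n^2/n=\kappa$. (ii) If $\liminf_{n\to\infty}\ell(n)=0$, then $S_n=\tfrac12\left[1+(-1)^{n-1}\right]X_1$ with probability one for every $n\ge1$.
   Context: The chain is defined on a probability space $(\Omega,\mathcal{A},P)$; $\pi\{B\}=P[W_n\in B]$ and $Q(w;B)=P[W_{n+1}\in B\mid W_n=w]$ for all $n\in\mathbb{Z}$. Reversibility means $\int_A Q(w;B)\,\pi\{dw\}=\int_B Q(w;A)\,\pi\{dw\}$ for all Borel sets $A,B\subseteq\mathcal{W}$. $L_0^2(\pi)=\{f\in L^2(\pi):\int_{\mathcal{W}} f\,d\pi=0\}$. *)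

(* Defs.v *)
From HB Require Import structures.
From mathcomp Require Import all_boot all_order all_algebra.
From mathcomp Require Import all_classical all_reals all_analysis.

Set Implicit Arguments.
Unset Strict Implicit.
Unset Printing Implicit Defensive.

Import Order.TTheory GRing.Theory Num.Theory.

Local Open Scope classical_set_scope.
Local Open Scope ring_scope.

Definition is_metric (R : realType) (T : Type) (dist : T -> T -> R) : Prop :=
  [/\ forall x y, 0 <= dist x y,
      forall x y, dist x y = 0 <-> x = y,
      forall x y, dist x y = dist y x &
      forall x y z, dist x z <= dist x y + dist y z].

Definition metrizes (R : realType) (T : topologicalType)
    (dist : T -> T -> R) : Prop :=
  forall A : set T, open A <->
    (forall x, A x -> exists2 e : R, 0 < e & [set y | dist x y < e] `<=` A).

Definition metric_complete (R : realType) (T : topologicalType)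
    (dist : T -> T -> R) : Prop :=
  forall u : nat -> T,
    (forall e : R, 0 < e -> exists N : nat, forall m n : nat,
       (N <= m)%N -> (N <= n)%N -> dist (u m) (u n) < e) ->
    exists l : T, u @ \oo --> l.

(* [R] only serves as the codomain of the metric. *)
Definition polish (R : realType) (T : topologicalType) : Prop :=
  (exists2 D : set T, countable D & dense D) /\
  (exists dist : T -> T -> R,
     [/\ is_metric dist, metrizes dist & metric_complete dist]).

(* [T] with its Borel sigma-algebra.  The base point required by the library
   costs no generality, since the state space of a chain is nonempty. *)
Notation borel T := (g_sigma_algebraType (@open T)).

Section Chain.
Context (R : realType) (d : measure_display) (Omega : measurableType d)
  (P : probability Omega R) (dW : measure_display) (W : measurableType dW).
Implicit Types (Y : int -> {RV P >-> W}) (Q : R.-pker W ~> W)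
  (pi : probability W R).

Definition stationary Y : Prop :=
  forall (h : int) (m : nat) (k : 'I_m -> int) (B : 'I_m -> set W),
    (forall i, measurable (B i)) ->
    P (\bigcap_(i in [set: 'I_m]) (Y (k i + h) @^-1` B i)) =
    P (\bigcap_(i in [set: 'I_m]) (Y (k i) @^-1` B i)).

Definition marginal Y pi : Prop :=
  forall (n : int) (B : set W), measurable B -> distribution P (Y n) B = pi B.

(* The sigma-algebra generated by (Y_m), m <= n. *)
Definition past Y (n : int) : set (set Omega) :=
  <<s \bigcup_(m in [set m : int | m <= n])
        preimage_set_system [set: Omega] (Y m) measurable >>.

(* Q(Y_n; B) is a version of P[Y_{n+1} \in B | Y_m, m <= n]; since it is a
   function of Y_n, it is also a version of P[Y_{n+1} \in B | Y_n]. *)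
Definition markov_chain Y Q : Prop :=
  forall (n : int) (A : set Omega) (B : set W), past Y n A -> measurable B ->
    P (A `&` Y (n + 1) @^-1` B) = (\int[P]_(w in A) Q (Y n w) B)%E.

Definition reversible Q pi : Prop :=
  forall A B : set W, measurable A -> measurable B ->
    (\int[pi]_(w in A) Q w B = \int[pi]_(w in B) Q w A)%E.

Definition L20 pi (g : W -> R) : Prop :=
  g \in Lfun pi 2%:E /\ (\int[pi]_w (g w)%:E = 0)%E.

Variables (Y : int -> {RV P >-> W}) (g : W -> R).

Definition summand (k : nat) : Omega -> R := fun w => g (Y k%:Z w).

Definition partial_sum (n : nat) : Omega -> R :=
  fun w => \sum_(1 <= k < n.+1) summand k w.

Definition sigma2 (n : nat) : \bar R := ('E_P[fun w => (partial_sum n w ^+ 2)%R])%E.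

(* Only meant for n >= 1. *)
Definition ell (n : nat) : \bar R := (sigma2 n * (n%:R^-1)%:E)%E.

End Chain.

(* Main.v *)
(* Write [c k] for the covariance of [X_0] and [X_k], that is <g, Q^k g> by the
   Markov property.  Reversibility makes Q self-adjoint, so that
   [c (i + j) = <Q^i g, Q^j g>]; expanding the squared norm of
   [x Q^k g + y Q^(k+1) g], the quadratic form
   [x^2 c (2k) + 2 x y c (2k+1) + y^2 c (2k+2)] is nonnegative.  Only bounded
   functions need to be fed to Q: the inequality for square-integrable g follows
   by truncation and dominated convergence.
   Let [B j] be the sum over [i <= j] of [c (2i) + 2 c (2i+1) + c (2i+2)]; it is
   nonnegative and nondecreasing.  Now [sigma_(2n+1)^2] is [c 0] plus twice the
   sum of the [B j], [j < n], and [sigma_(2n+2)^2] differs from it by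
   [B n - c (2n+2)], so [sigma_n^2 / n] converges to the limit of [B], and its
   liminf bounds every [B j].  If the liminf is 0 then [B 0 = 0], which forces
   [c 0 + c 1 = 0], i.e. [E (X_k + X_(k+1))^2 = 0] for all k. *)
Require Import Defs.
From mathcomp Require Import all_boot all_order all_algebra.
From mathcomp Require Import all_classical all_reals all_analysis.
From mathcomp Require Import measurable_realfun lra ring.

Set Implicit Arguments.
Unset Strict Implicit.
Unset Printing Implicit Defensive.

Import Order.TTheory GRing.Theory Num.Theory.
Import numFieldNormedType.Exports.

Local Open Scope classical_set_scope.
Local Open Scope ring_scope.

(** * Bounded measurable functions, and identities extended to them from indicators *)

Section BoundedMeasurable.
Context {R : realType}.

Definition bounded_mfun d (T : measurableType d) (f : T -> R) : Prop :=
  measurable_fun setT f /\ exists M : R, forall x, `|f x| <= M.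

Lemma bounded_mfun_cst d (T : measurableType d) (a : R) :
  bounded_mfun (fun _ : T => a).
Proof. by split; [exact: measurable_cst | exists `|a|]. Qed.

Lemma bounded_mfunD d (T : measurableType d) (f h : T -> R) :
  bounded_mfun f -> bounded_mfun h -> bounded_mfun (fun x => f x + h x).
Proof.
move=> [mf [M fM]] [mh [N hN]]; split; first exact: measurable_funD.
by exists (M + N) => x; rewrite (le_trans (ler_normD _ _))// lerD.
Qed.

Lemma bounded_mfunM d (T : measurableType d) (f h : T -> R) :
  bounded_mfun f -> bounded_mfun h -> bounded_mfun (fun x => f x * h x).
Proof.
move=> [mf [M fM]] [mh [N hN]]; split; first exact: measurable_funM.
by exists (M * N) => x; rewrite normrM ler_pM.
Qed.

Lemma bounded_mfun_lin d (T : measurableType d) (a : R) (f h : T -> R) :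
  bounded_mfun f -> bounded_mfun h -> bounded_mfun (fun x => a * f x + h x).
Proof.
by move=> bf bh; apply: bounded_mfunD => //; apply: bounded_mfunM => //;
  exact: bounded_mfun_cst.
Qed.

Lemma bounded_mfun_indic d (T : measurableType d) (A : set T) :
  measurable A -> bounded_mfun (\1_A : T -> R).
Proof.
move=> mA; split; first exact: measurable_indic.
by exists 1 => x; rewrite indicE; case: (x \in A); rewrite ?normr1 ?normr0.
Qed.

Lemma bounded_mfun_integrable d (T : measurableType d)
    (mu : {measure set T -> \bar R}) (f : T -> R) :
  (mu setT < +oo)%E -> bounded_mfun f -> mu.-integrable setT (EFin \o f).
Proof.
move=> muT [mf [M fM]]; apply: measurable_bounded_integrable => //.
exists M; split; first exact: num_real.
by move=> y My x _; exact: le_trans (fM x) (ltW My).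
Qed.

Lemma Rintegral_bound d (T : measurableType d)
    (mu : {measure set T -> \bar R}) (f : T -> R) (M : R) :
  mu setT = 1%E -> bounded_mfun f -> (forall x, `|f x| <= M) ->
  `|\int[mu]_x f x| <= M.
Proof.
move=> muT bf fM.
have muf : (mu setT < +oo)%E by rewrite muT ltry.
apply: (le_trans (le_normr_Rintegral _ _)) => //.
  exact: bounded_mfun_integrable.
have -> : M = \int[mu]_(x in setT) M by rewrite Rintegral_cst// muT/= mulr1.
apply: le_Rintegral => //; apply: bounded_mfun_integrable => //.
  case: bf => mf [N fN]; split; first exact: measurableT_comp.
  by exists N => x; rewrite normr_id.
exact: bounded_mfun_cst.
Qed.

Lemma Rintegral_lin d (T : measurableType d)
    (mu : {measure set T -> \bar R}) (a : R) (f h : T -> R) :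
  (mu setT < +oo)%E -> bounded_mfun f -> bounded_mfun h ->
  \int[mu]_x (a * f x + h x) = a * \int[mu]_x f x + \int[mu]_x h x.
Proof.
move=> muT bf bh.
have ba : bounded_mfun (fun x => a * f x).
  by apply: bounded_mfunM => //; exact: bounded_mfun_cst.
by rewrite RintegralD ?RintegralZl//; exact: bounded_mfun_integrable.
Qed.

(** Bounded linear functionals for the sup norm, with the norm expressed through arbitrary pointwise
    bounds [M]. Both clauses are confined to bounded measurable functions, where the integrals used
    later are additive. *)
Definition sup_continuous d (T : measurableType d) (F : (T -> R) -> R) : Prop :=
  (forall a f h, bounded_mfun f -> bounded_mfun h ->
    F (fun x => a * f x + h x) = a * F f + F h) /\
  (exists2 C : R, 0 <= C & forall f M, bounded_mfun f ->
    (forall x, `|f x| <= M) -> `|F f| <= C * M).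

(** A bounded measurable function is a uniform limit of simple functions; [F] kills these by
    linearity, hence also their limit. *)
Lemma sup_continuous_eq0 d (T : measurableType d) (F : (T -> R) -> R) :
  sup_continuous F -> (forall A, measurable A -> F \1_A = 0) ->
  forall f, bounded_mfun f -> F f = 0.
Proof.
move=> [Flin [C C0 FC]] F1 f bf; have [mf [M fM]] := bf.
have Fcst0 : F (fun=> 0) = 0.
  have := F1 set0 measurable0; rewrite (_ : \1_set0 = fun=> 0)//.
  by apply/funext => x; rewrite indicE in_set0.
have Fsum (I : Type) (s : seq I) (c : I -> R) (A : I -> set T) :
    (forall i, measurable (A i)) ->
    bounded_mfun (fun x => \sum_(i <- s) c i * \1_(A i) x) /\
    F (fun x => \sum_(i <- s) c i * \1_(A i) x) = 0.
  move=> mA; elim: s => [|i s [bs Fs]].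
    rewrite (_ : (fun x => _) = fun=> 0); last first.
      by apply/funext => x; rewrite big_nil.
    by split => //; exact: bounded_mfun_cst.
  rewrite (_ : (fun x => _) =
    fun x => c i * \1_(A i) x + \sum_(j <- s) c j * \1_(A j) x); last first.
    by apply/funext => x; rewrite big_cons.
  have bi : bounded_mfun (\1_(A i) : T -> R) by exact: bounded_mfun_indic.
  by split; [exact: bounded_mfun_lin|rewrite Flin// F1// Fs mulr0 addr0].
have approx (n : nat) : `|F f| <= C * n.+1%:R^-1.
  (* [u] is [f] shifted to be nonnegative and measured in units of 1/(n+1). On [A i], where [u] has
     integer part [i], [f] is within 1/(n+1) of [c i]. *)
  pose u x := n.+1%:R * (f x + M).
  have u0 x : 0 <= u x.
    by rewrite mulr_ge0// -lerBlDr sub0r; move: (fM x); rewrite ler_norml => /andP[].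
  have mu : measurable_fun setT u.
    by apply: measurable_funM => //; exact: measurable_funD.
  pose N := (Num.truncn (n.+1%:R * (M + M))).+1.
  pose A (i : nat) := u @^-1` `[i%:R, i.+1%:R[.
  have mA i : measurable (A i).
    by rewrite -[A i]setTI; exact: mu.
  pose c (i : nat) : R := i%:R / n.+1%:R - M.
  have [bS FS] := Fsum _ (index_iota 0 N) c A mA.
  set S := (fun x => _) in bS FS.
  have SE x : S x = (Num.truncn (u x))%:R / n.+1%:R - M.
    rewrite /S (bigD1_seq (Num.truncn (u x))) ?iota_uniq//=; last first.
      rewrite mem_index_iota/= ltnS; apply: le_truncn.
      rewrite ler_wpM2l// lerD2r.
      by move: (fM x); rewrite ler_norml => /andP[].
    rewrite indicE mem_set ?mulr1; last first.
      by rewrite /A/= in_itv/= truncn_le// u0 truncnS_gt.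
    rewrite big1 ?addr0// => i iu; rewrite indicE memNset ?mulr0//.
    rewrite /A/= in_itv/= => ui; move/eqP: iu; apply.
    by apply/esym/truncn_def.
  have -> : F f = F (fun x => -1 * S x + f x) by rewrite Flin// FS; lra.
  apply: FC; first exact: bounded_mfun_lin.
  move=> x; rewrite SE.
  have n0 : (0 : R) < n.+1%:R by [].
  have -> : -1 * ((Num.truncn (u x))%:R / n.+1%:R - M) + f x =
            (u x - (Num.truncn (u x))%:R) / n.+1%:R.
    by rewrite /u; field; rewrite lt0r_neq0.
  rewrite normrM normfV [X in _ / X]ger0_norm; last exact: ltW.
  rewrite ler_pdivrMr// mulVf ?lt0r_neq0//.
  have := truncnS_gt (u x); have := truncn_le (u x); rewrite u0.
  by rewrite -natr1 ler_norml; lra.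
apply/normr0_eq0/eqP; rewrite eq_le normr_ge0 andbT.
apply/ler_addgt0Pl => e e0; rewrite addr0.
pose n := Num.truncn (C / e).
apply: (le_trans (approx n)); rewrite ler_pdivrMr// mulrC -ler_pdivrMr//.
by apply/ltW; exact: truncnS_gt.
Qed.

Lemma sup_continuous_eq d (T : measurableType d) (F G : (T -> R) -> R) :
  sup_continuous F -> sup_continuous G ->
  (forall A, measurable A -> F \1_A = G \1_A) ->
  forall f, bounded_mfun f -> F f = G f.
Proof.
move=> [Fl [C C0 FC]] [Gl [D D0 GD]] FG f bf; apply/eqP; rewrite -subr_eq0.
apply/eqP; apply: (@sup_continuous_eq0 _ _ (fun f => F f - G f)) => //; last first.
  by move=> A mA; rewrite FG ?subrr.
split; first by move=> a u v bu bv; rewrite Fl// Gl//; ring.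
exists (C + D) => [|u M bu uM]; first exact: addr_ge0.
rewrite mulrDl (le_trans (ler_normB _ _))// lerD//; first exact: FC.
exact: GD.
Qed.

(** The common shape of the identity, of composition with [Y n] and of the operator Q, closed under
    composition, so that one extension lemma serves for all of them. *)
Definition sup_contraction d (T : measurableType d) d' (T' : measurableType d')
    (L : (T -> R) -> T' -> R) : Prop :=
  [/\ forall f, bounded_mfun f -> bounded_mfun (L f),
      forall a f h x, bounded_mfun f -> bounded_mfun h ->
        L (fun y => a * f y + h y) x = a * L f x + L h x &
      forall f M, bounded_mfun f -> (forall y, `|f y| <= M) ->
        forall x, `|L f x| <= M].

Lemma sup_contraction_id d (T : measurableType d) :
  sup_contraction (fun f : T -> R => f).
Proof. by split. Qed.

Lemma sup_contraction_precomp d (T : measurableType d) d'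
    (T' : measurableType d') (Z : T' -> T) :
  measurable_fun setT Z -> sup_contraction (fun f : T -> R => f \o Z).
Proof.
move=> mZ; split => //= f [mf [M fM]].
by split; [exact: measurableT_comp|exists M => x; exact: fM].
Qed.

Lemma sup_contraction_comp d (T : measurableType d) d' (T' : measurableType d')
    d'' (T'' : measurableType d'')
    (L : (T -> R) -> T' -> R) (K : (T' -> R) -> T'' -> R) :
  sup_contraction L -> sup_contraction K -> sup_contraction (K \o L).
Proof.
move=> [bL lL cL] [bK lK cK]; split => /=.
- by move=> f bf; exact/bK/bL.
- move=> a f h x bf bh.
  rewrite -lK; [|exact: bL..]; congr (K _ x).
  by apply/funext => y; exact: lL.
- by move=> f M bf fM x; apply: cK; [exact: bL|exact: cL].
Qed.

Lemma pker_fin_num d (T : measurableType d) (Q : R.-pker T ~> T) (x : T)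
    (B : set T) : measurable B -> Q x B \is a fin_num.
Proof.
move=> mB; rewrite ge0_fin_numE//; apply: (@le_lt_trans _ _ (Q x setT)).
  by apply: le_measure => //; rewrite inE.
by rewrite prob_kernel ltry.
Qed.

Definition markov_op d (T : measurableType d) (Q : R.-pker T ~> T)
    (f : T -> R) (x : T) : R := \int[Q x]_y f y.

Lemma sup_contraction_markov_op d (T : measurableType d) (Q : R.-pker T ~> T) :
  sup_contraction (markov_op Q).
Proof.
have Q1 x : Q x setT = 1%E by exact: prob_kernel.
have Qfin x : (Q x setT < +oo)%E by rewrite Q1 ltry.
split => [f bf|a f h x bf bh|f M bf fM x]; last 2 first.
- exact: Rintegral_lin.
- exact: Rintegral_bound.
have [mf [M fM]] := bf; split; last first.
  by exists M => x; exact: Rintegral_bound.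
(* Measurability of kernel integrals is applied to a nonnegative integrand, hence the shift by [M];
   as [Q x] has mass 1, it is undone by subtracting [M]. *)
pose F x := (\int[Q x]_y (f y + M)%:E)%E.
have mF : measurable_fun setT F.
  apply: measurable_fun_integral_kernel.
  - by move=> U mU; exact: measurable_kernel.
  - move=> z; rewrite lee_fin -lerBlDr sub0r.
    by move: (fM z); rewrite ler_norml => /andP[].
  - by apply/measurable_EFinP; exact: measurable_funD.
rewrite (_ : markov_op Q f = fun x => fine (F x) - M); last first.
  apply/funext => x.
  have -> : fine (F x) = \int[Q x]_y (1 * f y + M).
    by under [RHS]eq_Rintegral do rewrite mul1r.
  rewrite Rintegral_lin//; last exact: bounded_mfun_cst.
  by rewrite Rintegral_cst// Q1 mul1r mulr1 addrK.
by apply: measurable_funB => //; exact: measurableT_comp.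
Qed.

Lemma markov_op_indic d (T : measurableType d) (Q : R.-pker T ~> T) (B : set T)
    (x : T) : measurable B -> markov_op Q \1_B x = fine (Q x B).
Proof. by move=> mB; rewrite /markov_op/Rintegral integral_indic// setIT. Qed.

Lemma sup_continuous_mulr d (T : measurableType d) d' (T' : measurableType d')
    (mu : probability T' R) (L : (T -> R) -> T' -> R) (u : T' -> R) :
  sup_contraction L -> bounded_mfun u ->
  sup_continuous (fun f => \int[mu]_x (u x * L f x)).
Proof.
move=> [bL lL cL] bu; have [mu_ [C uC]] := bu.
have mu1 : mu setT = 1%E by exact: probability_setT.
have mufin : (mu setT < +oo)%E by rewrite mu1 ltry.
split=> [a f h bf bh|].
  rewrite -Rintegral_lin//; [|by apply: bounded_mfunM => //; exact: bL..].
  by apply: eq_Rintegral => x _; rewrite lL//; ring.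
exists `|C| => // f M bf fM; apply: Rintegral_bound => //.
  by apply: bounded_mfunM => //; exact: bL.
move=> x; rewrite normrM ler_pM//; last exact: cL.
by rewrite (le_trans (uC x))// ler_norm.
Qed.

(** With one argument fixed, each side is a [sup_continuous] functional of the other, so indicators
    are replaced by functions one argument at a time. This turns the set-wise marginal, Markov and
    reversibility conditions into identities between integrals of functions. *)
Lemma bilinear_eq d (T : measurableType d) d1 (T1 : measurableType d1)
    d2 (T2 : measurableType d2) (mu : probability T1 R) (nu : probability T2 R)
    (K L : (T -> R) -> T1 -> R) (K' L' : (T -> R) -> T2 -> R) :
  sup_contraction K -> sup_contraction L ->
  sup_contraction K' -> sup_contraction L' ->
  (forall A B, measurable A -> measurable B ->
    \int[mu]_x (K \1_A x * L \1_B x) = \int[nu]_x (K' \1_A x * L' \1_B x)) ->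
  forall f h, bounded_mfun f -> bounded_mfun h ->
    \int[mu]_x (K f x * L h x) = \int[nu]_x (K' f x * L' h x).
Proof.
move=> cK cL cK' cL' AB f h bf bh.
have [[bK _ _] [bL _ _]] := (cK, cL); have [[bK' _ _] [bL' _ _]] := (cK', cL').
apply: (@sup_continuous_eq _ _ (fun h => \int[mu]_x (K f x * L h x))
  (fun h => \int[nu]_x (K' f x * L' h x))) => //.
- by apply: sup_continuous_mulr => //; exact: bK.
- by apply: sup_continuous_mulr => //; exact: bK'.
move=> B mB.
under eq_Rintegral do rewrite mulrC.
under [RHS]eq_Rintegral do rewrite mulrC.
apply: (@sup_continuous_eq _ _ (fun f => \int[mu]_x (L \1_B x * K f x))
  (fun f => \int[nu]_x (L' \1_B x * K' f x))) => //.
- by apply: sup_continuous_mulr => //; apply: bL; exact: bounded_mfun_indic.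
- by apply: sup_continuous_mulr => //; apply: bL'; exact: bounded_mfun_indic.
move=> A mA.
under eq_Rintegral do rewrite mulrC.
under [RHS]eq_Rintegral do rewrite mulrC.
exact: AB.
Qed.

End BoundedMeasurable.

(** * Products and squares of square-integrable functions *)

Section SquareIntegrable.
Context {R : realType} {d : measure_display} {T : measurableType d}
  {mu : probability T R}.

Lemma Lfun2_integrable_mul (f h : T -> R) :
  f \in Lfun mu 2%:E -> h \in Lfun mu 2%:E ->
  mu.-integrable setT (EFin \o (fun x => f x * h x)).
Proof. by move=> Lf Lh; exact/Lfun1_integrable/Lfun2_mul_Lfun1. Qed.

Lemma Lfun2D (f h : T -> R) :
  f \in Lfun mu 2%:E -> h \in Lfun mu 2%:E -> f \+ h \in Lfun mu 2%:E.
Proof. by move=> Lf Lh; rewrite rpredD ?lee1n. Qed.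

Lemma Lfun2_sqr_linear (a : R) (f h : T -> R) :
  f \in Lfun mu 2%:E -> h \in Lfun mu 2%:E ->
  \int[mu]_x (f x + a * h x) ^+ 2 =
  \int[mu]_x (f x * f x) + 2 * a * \int[mu]_x (f x * h x)
    + a ^+ 2 * \int[mu]_x (h x * h x).
Proof.
move=> Lf Lh.
have Iff := Lfun2_integrable_mul Lf Lf.
have Ifh := Lfun2_integrable_mul Lf Lh.
have Ihh := Lfun2_integrable_mul Lh Lh.
have IZ c u : mu.-integrable setT (EFin \o u) ->
    mu.-integrable setT (EFin \o (fun x : T => c * u x)).
  by move=> iu; exact: (integrableZl measurableT c iu).
have IfZ := IZ (2 * a) _ Ifh.
have IhZ := IZ (a ^+ 2) _ Ihh.
have Isum : mu.-integrable setT
    (EFin \o (fun x : T => f x * f x + 2 * a * (f x * h x))).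
  exact: (integrableD measurableT Iff IfZ).
rewrite -[in RHS]RintegralZl// -[in RHS]RintegralZl// -RintegralD// -RintegralD//.
by apply: eq_Rintegral => x _; ring.
Qed.

End SquareIntegrable.

Lemma le_limn_einf (R : realType) (u : (\bar R)^nat) (a : \bar R) (N : nat) :
  (forall n, (N <= n)%N -> (a <= u n)%E) -> (a <= limn_einf u)%E.
Proof.
move=> au; rewrite limn_einf_lim; apply: (@le_trans _ _ (einfs u N)).
  by apply: le_ereal_inf_tmp => _ [n /= Nn <-]; exact: au.
rewrite (cvg_lim _ (@cvg_einfs_sup _ u))//.
by apply: ereal_sup_ubound; exists N.
Qed.

(** * Deterministic asymptotics of the variances in terms of the covariances *)

Section Sequences.
Context {R : realType}.
Variables (c V : nat -> R).

(** This is [B j] of the overview; [c] stands for the covariances and [V] for the variances of the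
    partial sums. *)
Definition pair_sum (j : nat) : R :=
  \sum_(0 <= i < j.+1) (c i.*2 + 2 * c i.*2.+1 + c i.*2.+2).

Hypothesis c_ge0 : forall j, 0 <= c j.*2.
Hypothesis c_le : forall j, c j <= c 0.
Hypothesis pair_ge0 : forall i, 0 <= c i.*2 + 2 * c i.*2.+1 + c i.*2.+2.
Hypothesis V0 : V 0 = 0.
Hypothesis VS : forall n, V n.+1 = V n + c 0 + 2 * \sum_(1 <= k < n.+1) c k.

Let c0_ge0 : 0 <= c 0. Proof. exact: (c_ge0 0). Qed.

Lemma pair_sum_nd (i j : nat) : (i <= j)%N -> pair_sum i <= pair_sum j.
Proof.
move=> /subnK <-; elim: (j - i)%N => // n IH; apply: (le_trans IH).
rewrite addSn {2}/pair_sum big_nat_recr//= -/(pair_sum _).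
by rewrite lerDl.
Qed.

Lemma pair_sum_ge0 (j : nat) : 0 <= pair_sum j.
Proof. by apply: sumr_ge0 => i _. Qed.

(** Neighbouring summands share an even-index term, so every covariance is counted twice except the
    two at the ends. *)
Lemma pair_sumE (j : nat) :
  pair_sum j = c 0 + 2 * \sum_(1 <= k < j.*2.+2) c k + c j.*2.+2.
Proof.
elim: j => [|j IH]; first by rewrite /pair_sum !big_nat1.
rewrite /pair_sum big_nat_recr//= -/(pair_sum j) IH doubleS.
by rewrite [in RHS]big_nat_recr//= [in RHS]big_nat_recr//=; ring.
Qed.

(** By [pair_sumE], two consecutive increments of [V], from 2n+1 to 2n+3, add up to exactly
    [2 * pair_sum n]. *)
Lemma double_sum_odd (n : nat) :
  V n.*2.+1 = c 0 + 2 * \sum_(0 <= j < n) pair_sum j.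
Proof.
elim: n => [|n IH]; first by rewrite VS V0 !big_geq// !mulr0 !addr0 add0r.
rewrite doubleS VS VS IH (@big_nat_recr _ _ _ n.*2.+2)//=.
by rewrite (@big_nat_recr _ _ _ n 0)//= pair_sumE; ring.
Qed.

Lemma double_sum_even (n : nat) :
  V n.*2.+2 = V n.*2.+1 + pair_sum n - c n.*2.+2.
Proof. by rewrite VS pair_sumE; ring. Qed.

Let natr_double (n : nat) : n.*2%:R = 2 * n%:R :> R.
Proof. by rewrite -muln2 natrM mulrC. Qed.

Let natr_double1 (n : nat) : n.*2.+1%:R = 2 * n%:R + 1 :> R.
Proof. by rewrite -natr1 natr_double. Qed.

Let natr_double2 (n : nat) : n.*2.+2%:R = 2 * n%:R + 2 :> R.
Proof. by rewrite -natr1 natr_double1 -addrA. Qed.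

(** Each [pair_sum] in [double_sum_odd] is replaced by [k]; for even indices the subtracted
    covariance is nonnegative and is dropped. *)
Lemma double_sum_upper (k : R) (n : nat) : (forall j, pair_sum j <= k) ->
  V n <= n%:R * k + c 0.
Proof.
move=> Bk; have k0 : 0 <= k by exact: le_trans (pair_sum_ge0 0) (Bk 0).
have odd_bound m : V m.*2.+1 <= c 0 + 2 * (m%:R * k).
  rewrite double_sum_odd lerD2l ler_wpM2l//.
  have -> : m%:R * k = \sum_(0 <= j < m) k.
    by rewrite big_const_nat iter_addr_0 subn0 mulr_natl.
  by apply: ler_sum_nat => j _.
case: n => [|n]; first by rewrite V0 mul0r add0r.
have := odd_double_half n; case: (odd n) => /= <-; last first.
  have := odd_bound n./2; rewrite add0n natr_double1.
  by move: k0; nra.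
have := odd_bound n./2; have := double_sum_even n./2; have := Bk n./2.
have := c_ge0 n./2.+1; rewrite doubleS add1n.
set p := V _; set q := V _; set b := pair_sum _; set e := c n./2.*2.+2.
rewrite natr_double2.
by move: k0; nra.
Qed.

(** The terms [pair_sum j] are at least [pair_sum J] from [J] on and nonnegative before, so the loss
    does not depend on [n]. The even case fixes the constant: there n = 2m+2 leaves n - (2J+2)
    copies of [pair_sum J], and the subtracted covariance costs at most [c 0]. *)
Lemma double_sum_lower (J n : nat) :
  n%:R * pair_sum J - (J.*2.+2%:R * pair_sum J + c 0) <= V n.
Proof.
set b := pair_sum J; have b0 : 0 <= b by exact: pair_sum_ge0.
have odd_bound m : 2 * ((m%:R - J%:R) * b) <= V m.*2.+1.
  rewrite double_sum_odd -[leLHS]add0r lerD// ler_wpM2l//.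
  have [mJ|Jm] := leqP m J.
    apply: (@le_trans _ _ 0); last first.
      by apply: sumr_ge0 => i _; exact: pair_sum_ge0.
    by rewrite mulr_le0_ge0// subr_le0 ler_nat.
  rewrite (big_cat_nat (leq0n J) (ltnW Jm))/= -[leLHS]add0r lerD//.
    by apply: sumr_ge0 => i _; exact: pair_sum_ge0.
  have -> : (m%:R - J%:R) * b = \sum_(J <= j < m) b.
    by rewrite big_const_nat iter_addr_0 -natrB ?mulr_natl// ltnW.
  by apply: ler_sum_nat => j /andP[Jj _]; exact: pair_sum_nd.
case: n => [|n].
  by rewrite V0 mul0r sub0r oppr_le0 addr_ge0// mulr_ge0.
have := odd_double_half n; case: (odd n) => /= <-; last first.
  have := odd_bound n./2; rewrite add0n natr_double1 natr_double2.
  by move: b0 c0_ge0; nra.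
have := odd_bound n./2; have := double_sum_even n./2; have := c_le n./2.*2.+2.
have := pair_sum_ge0 n./2; rewrite add1n.
set p := V _; set q := V _; set b' := pair_sum _; set e := c n./2.*2.+2.
by rewrite !natr_double2; move: b0 c0_ge0; nra.
Qed.

Lemma double_sum_cvg (M : R) : (forall j, pair_sum j <= M) ->
  exists2 k : R, 0 <= k & V n / n%:R @[n --> \oo] --> k.
Proof.
move=> BM.
have nd : nondecreasing_seq pair_sum by move=> i j; exact: pair_sum_nd.
have ub : has_ubound (range pair_sum) by exists M => _ [j _ <-].
(* The limit is the supremum of the monotone sequence [pair_sum]; [J] below comes within [e / 2] of
   it. *)
pose k := sup (range pair_sum).
have Bk j : pair_sum j <= k by apply: ub_le_sup => //; exists j.
have k0 : 0 <= k := le_trans (pair_sum_ge0 0) (Bk 0).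
exists k => //; apply/cvgrPdist_le => e e0.
have [_ [J _ <-] kJ] : exists2 x, range pair_sum x & k - e / 2 < x.
  apply: sup_adherent; first by rewrite divr_gt0.
  by split => //; exists (pair_sum 0), 0%N.
set b := pair_sum J in kJ; have b0 : 0 <= b := pair_sum_ge0 J.
(* The error term of [double_sum_lower]. It dominates the [c 0] of [double_sum_upper], so one
   threshold on [n] serves both sides. *)
pose C := J.*2.+2%:R * b + c 0.
have C0 : 0 <= C by rewrite addr_ge0// mulr_ge0.
have c0C : c 0 <= C by rewrite lerDr mulr_ge0.
exists (Num.truncn (C / (e / 2))).+1 => // n /= nC.
have n0 : 0 < n%:R :> R by rewrite ltr0n (leq_trans _ nC).
have Cn : C <= n%:R * (e / 2).
  rewrite -ler_pdivrMr ?divr_gt0//.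
  apply/ltW/(lt_le_trans (truncnS_gt _)); by rewrite ler_nat.
rewrite ler_distl; apply/andP; split.
  rewrite lerBlDr -(ler_pM2l n0) mulrCA divff ?lt0r_neq0// mulr1.
  by have := double_sum_upper n Bk; nra.
rewrite -lerBlDr -(ler_pM2l n0) [leRHS]mulrCA divff ?lt0r_neq0// mulr1.
by have := double_sum_lower J n; rewrite -/b -/C; nra.
Qed.

(** Dividing [double_sum_lower] by [n] makes its error vanish. [pair_sum] is not assumed bounded
    here: this is how a finite liminf yields the bound that [double_sum_cvg] requires. *)
Lemma pair_sum_le_limn_einf (J : nat) :
  ((pair_sum J)%:E <= limn_einf (fun n => (V n / n%:R)%:E))%E.
Proof.
apply/lee_subgt0Pr => e e0; rewrite -EFinB.
set b := pair_sum J; have b0 : 0 <= b := pair_sum_ge0 J.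
pose C := J.*2.+2%:R * b + c 0.
have C0 : 0 <= C by rewrite addr_ge0// mulr_ge0.
apply: (le_limn_einf (N := (Num.truncn (C / e)).+1)) => n nC; rewrite lee_fin.
have n0 : 0 < n%:R :> R by rewrite ltr0n (leq_trans _ nC).
have Cn : C <= n%:R * e.
  rewrite -ler_pdivrMr//.
  apply/ltW/(lt_le_trans (truncnS_gt _)); by rewrite ler_nat.
rewrite -(ler_pM2l n0) [leRHS]mulrCA divff ?lt0r_neq0// mulr1.
have := double_sum_lower J n; rewrite -/b -/C => ?; nra.
Qed.

End Sequences.

(** * The reversible chain tested on bounded functions *)

Section ReversibleChain.
Context {R : realType} {d : measure_display} {Omega : measurableType d}
  {P : probability Omega R} {dW : measure_display} {W : measurableType dW}
  {Y : int -> {RV P >-> W}} {Q : R.-pker W ~> W} { pi : probability W R}.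
Hypotheses (hmarkov : markov_chain Y Q) (hmarg : marginal Y pi)
  (hrev : reversible Q pi).

Let mY (n : int) : measurable_fun setT (Y n).
Proof. exact: measurable_funPT. Qed.

Lemma Rintegral_marginal (m : int) (f : W -> R) : bounded_mfun f ->
  \int[P]_x f (Y m x) = \int[pi]_w f w.
Proof.
move=> bf.
have idc := @sup_contraction_id R _ W.
have Yc := @sup_contraction_precomp R _ W _ Omega _ (mY m).
(* A second factor equal to 1 brings both integrals into the form of [bilinear_eq]. *)
have b1 := @bounded_mfun_cst R _ W 1.
under eq_Rintegral do rewrite -[f _]mulr1.
under [RHS]eq_Rintegral do rewrite -[f _]mulr1.
apply: (bilinear_eq (mu := P) (nu := pi) Yc Yc idc idc _ bf b1) => A B mA mB.
under eq_Rintegral => x _ do rewrite /= -[_ * _]/((\1_A \* \1_B) (Y m x)) -indicI.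
under [RHS]eq_Rintegral => x _ do rewrite /= -[_ * _]/((\1_A \* \1_B) x) -indicI.
have mAB : measurable (A `&` B) by exact: measurableI.
transitivity (fine (P (Y m @^-1` (A `&` B)))).
  rewrite -[X in P X]setIT -integral_indic//.
  by rewrite -[X in measurable X]setTI; exact: mY.
by rewrite /Rintegral integral_indic// setIT; congr fine; exact: hmarg.
Qed.

(** On indicators this is reversibility itself. *)
Lemma markov_op_self_adjoint (f h : W -> R) :
  bounded_mfun f -> bounded_mfun h ->
  \int[pi]_w (f w * markov_op Q h w) = \int[pi]_w (markov_op Q f w * h w).
Proof.
have idc := @sup_contraction_id R _ W.
have Qc := sup_contraction_markov_op Q.
apply: (bilinear_eq idc Qc Qc idc) => A B mA mB.
have E (C D : set W) : measurable C -> measurable D ->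
    \int[pi]_w (\1_C w * markov_op Q \1_D w) = fine (\int[pi]_(w in C) Q w D)%E.
  move=> mC mD; rewrite integral_mkcond; congr fine; apply: eq_integral => w _.
  rewrite markov_op_indic// patchE indicE; case: ifP => _; rewrite ?mul0r// mul1r.
  by rewrite fineK//; exact: pker_fin_num.
rewrite E// hrev//; last rewrite -E//.
by apply: eq_Rintegral => w _; rewrite mulrC.
Qed.

(** On indicators this is the Markov property for the event that [Y m] lies in [A], which belongs to
    the past of [n] since [m <= n]. *)
Lemma markov_step (m n : int) (f h : W -> R) : m <= n ->
  bounded_mfun f -> bounded_mfun h ->
  \int[P]_x (f (Y m x) * h (Y (n + 1) x)) =
  \int[P]_x (f (Y m x) * markov_op Q h (Y n x)).
Proof.
move=> mn.
have Yc k := @sup_contraction_precomp R _ W _ Omega _ (mY k).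
have Qc := sup_contraction_markov_op Q.
apply: (bilinear_eq (mu := P) (nu := P) (Yc m) (Yc (n + 1)) (Yc m)
  (sup_contraction_comp Qc (Yc n))) => A B mA mB.
set A' := Y m @^-1` A.
have mA' : measurable A' by rewrite -[A']setTI; exact: mY.
have mB' : measurable (Y (n + 1) @^-1` B).
  by rewrite -[X in measurable X]setTI; exact: mY.
have pA : past Y n A'.
  by apply: sub_sigma_algebra; exists m => //; exists A => //; rewrite setTI.
have := hmarkov pA mB => /(congr1 fine).
rewrite integral_mkcond -[X in P X]setIT -integral_indic//; last exact: measurableI.
move=> E; apply: (etrans _ (etrans E _)); congr fine; apply: eq_integral => x _.
  by rewrite indicI.
rewrite patchE /= markov_op_indic//.
rewrite -[\1_A (Y m x)]/(\1_A' x) indicE; case: ifP => _; rewrite ?mul0r// mul1r.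
by rewrite fineK//; exact: pker_fin_num.
Qed.

Let bounded_iter (k : nat) (f : W -> R) : bounded_mfun f ->
  bounded_mfun (iter k (markov_op Q) f).
Proof.
move=> bf; elim: k => //= k; have [bQ _ _] := sup_contraction_markov_op Q.
exact: bQ.
Qed.

(** Each [markov_step] shortens the lag by one and applies Q to [h], so the induction is on all [h]
    at once. *)
Lemma Rintegral_lag (m : int) (k : nat) (f h : W -> R) :
  bounded_mfun f -> bounded_mfun h ->
  \int[P]_x (f (Y m x) * h (Y (m + k%:Z) x)) =
  \int[pi]_w (f w * iter k (markov_op Q) h w).
Proof.
move=> bf; elim: k h => [|k IH] h bh.
  rewrite addr0 -(Rintegral_marginal m)//; exact: bounded_mfunM.
rewrite intS [1 + _]addrC addrA markov_step// ?lerDl// iterSr.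
by apply: IH; exact: (bounded_iter 1).
Qed.

(** Self-adjointness moves [i] of the [i + j] copies of Q to the left factor, one at a time. *)
Lemma Rintegral_iter_shift (i j : nat) (f h : W -> R) :
  bounded_mfun f -> bounded_mfun h ->
  \int[pi]_w (f w * iter (i + j) (markov_op Q) h w) =
  \int[pi]_w (iter i (markov_op Q) f w * iter j (markov_op Q) h w).
Proof.
elim: i f => // i IH f bf bh.
rewrite addSn iterS markov_op_self_adjoint//; last exact: bounded_iter.
by rewrite iterSr IH//; exact: (bounded_iter 1).
Qed.

Definition bounded_cov (f : W -> R) (k : nat) : R :=
  \int[pi]_w (f w * iter k (markov_op Q) f w).

Lemma bounded_cov_hankel (f : W -> R) (k : nat) (x y : R) : bounded_mfun f ->
  0 <= x ^+ 2 * bounded_cov f k.*2 + 2 * x * y * bounded_cov f k.*2.+1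
       + y ^+ 2 * bounded_cov f k.*2.+2.
Proof.
move=> bf.
pose u i := iter i (markov_op Q) f.
have bu i : bounded_mfun (u i) by exact: bounded_iter.
have covE i j : bounded_cov f (i + j) = \int[pi]_w (u i w * u j w).
  exact: Rintegral_iter_shift.
have -> : (k.*2.+2 = k.+1 + k.+1)%N by rewrite addnn.
have -> : (k.*2.+1 = k + k.+1)%N by rewrite addnS addnn.
rewrite -addnn !covE.
have pifin : (pi setT < +oo)%E by rewrite probability_setT ltry.
set Z := (X in _ <= X).
have -> : Z = \int[pi]_w (x * u k w + y * u k.+1 w) ^+ 2.
  (* The nesting and the final [+ 0] match the shape [a * f + h] of [Rintegral_lin], which then
     splits off the three terms in turn. *)
  transitivity (\int[pi]_w (x ^+ 2 * (u k w * u k w) +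
      (2 * x * y * (u k w * u k.+1 w) + (y ^+ 2 * (u k.+1 w * u k.+1 w) + 0)))).
    have b0 := @bounded_mfun_cst R _ W 0.
    have buu i j : bounded_mfun (fun w => u i w * u j w) by exact: bounded_mfunM.
    have b1 := bounded_mfun_lin (y ^+ 2) (buu k.+1 k.+1) b0.
    have b2 := bounded_mfun_lin (2 * x * y) (buu k k.+1) b1.
    rewrite !Rintegral_lin// Rintegral_cst// mul0r addr0 addrA.
    by [].
  by apply: eq_Rintegral => w _; ring.
by apply: Rintegral_ge0 => w _; exact: sqr_ge0.
Qed.

(** * Covariances of a square-integrable [g], by truncation *)

Variable g : W -> R.
Hypothesis Lg : g \in Lfun pi 2%:E.

Let mg : measurable_fun setT g.
Proof. by move: Lg; rewrite inE => /andP[]; rewrite inE. Qed.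

Lemma chain_Lfun2 (n : int) : g \o Y n \in Lfun P 2%:E.
Proof.
rewrite inE; apply/andP; split; rewrite inE/=; first exact: measurableT_comp.
move: Lg; rewrite inE => /andP[_]; rewrite inE/= /finite_norm.
suff -> : 'N[P]_2[EFin \o (g \o Y n)]%E = 'N[pi]_2[EFin \o g]%E by [].
rewrite unlock; congr (_ `^ _)%E.
rewrite (eq_measure_integral (m1 := pi) (distribution P (Y n))); last first.
  by move=> A mA _; exact/esym/hmarg.
rewrite ge0_integral_pushforward//.
by apply: (measurableT_comp (measurable_poweR _)) => //;
  apply: measurableT_comp => //; exact/measurable_EFinP.
by move=> w _; exact: poweR_ge0.
Qed.

Definition cov (k : nat) : R := \int[P]_x (g (Y 0 x) * g (Y k%:Z x)).

Definition truncation (N : nat) (w : W) : R :=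
  g w * \1_[set v | `|g v| <= N%:R] w.

Lemma bounded_truncation (N : nat) : bounded_mfun (truncation N).
Proof.
split.
  apply: measurable_funM => //; apply: measurable_indic.
  rewrite -[X in measurable X]setTI.
  rewrite (_ : [set v | _] = (fun v => `|g v|) @^-1` `]-oo, N%:R]); last first.
    by apply/seteqP; split => v /=; rewrite in_itv.
  have ng : measurable_fun setT (fun v => `|g v|) by exact: measurableT_comp.
  exact: ng.
exists N%:R => w; rewrite /truncation indicE; case: (boolP (w \in _)) => [|_].
  by rewrite inE mulr1.
by rewrite mulr0 normr0.
Qed.

(** At each point the truncated product is eventually equal to the full one, and it is dominated by
    the absolute value of the latter, a product of two square-integrable functions. *)
Lemma truncation_cvg (m n : int) :
  \int[P]_x (truncation N (Y m x) * truncation N (Y n x)) @[N --> \oo] -->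
  \int[P]_x (g (Y m x) * g (Y n x)).
Proof.
have I := Lfun2_integrable_mul (chain_Lfun2 m) (chain_Lfun2 n).
have mT N k : measurable_fun setT (fun x => truncation N (Y k x)).
  by have [mt _] := bounded_truncation N; exact: measurableT_comp.
have [|||||_ _ H] := dominated_convergence (mu := P) measurableT
  (f_ := fun N x => (truncation N (Y m x) * truncation N (Y n x))%:E)
  (f := fun x => (g (Y m x) * g (Y n x))%:E)
  (g := fun x => `|(g (Y m x) * g (Y n x))%:E|%E).
- by move=> N; apply/measurable_EFinP; exact: measurable_funM.
- exact: measurable_int I.
- apply: aeW => x _; apply: cvg_near_cst.
  pose M := Num.max `|g (Y m x)| `|g (Y n x)|.
  exists (Num.truncn M).+1 => // N /= MN.
  have MN' : M <= N%:R by rewrite (le_trans (ltW (truncnS_gt M)))// ler_nat.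
  have tr k : `|g (Y k x)| <= M -> truncation N (Y k x) = g (Y k x).
    move=> kM; rewrite /truncation indicE mem_set ?mulr1//=.
    exact: le_trans MN'.
  by rewrite !tr// /M le_max lexx ?orbT.
- exact: (integrable_abse I).
- apply: aeW => x N _; rewrite /= lee_fin [leLHS]normrM [leRHS]normrM.
  have tr w : `|truncation N w| <= `|g w|.
    rewrite /truncation normrM ler_piMr// indicE.
    by case: (_ \in _); rewrite ?normr1 ?normr0.
  by apply: ler_pM.
apply: fine_cvg; rewrite fineK//; exact: integrable_fin_num I.
Qed.

Lemma bounded_cov_cvg (m : int) (k : nat) :
  bounded_cov (truncation N) k @[N --> \oo] -->
  \int[P]_x (g (Y m x) * g (Y (m + k%:Z) x)).
Proof.
have := truncation_cvg (m := m) (n := m + k%:Z).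
apply: cvg_trans; apply: near_eq_cvg; apply: nearW => N.
have bt := bounded_truncation N.
by rewrite /bounded_cov -(Rintegral_lag m).
Qed.

(** By [bounded_cov_cvg] the same sequence, which does not involve [m], converges to the left side
    for every [m]; limits are unique. *)
Lemma cov_lag (m : int) (k : nat) :
  \int[P]_x (g (Y m x) * g (Y (m + k%:Z) x)) = cov k.
Proof.
have H := @bounded_cov_cvg m k; have H0 := @bounded_cov_cvg 0 k.
rewrite -(cvg_lim _ H)// (cvg_lim _ H0)//.
Qed.

Lemma cov_hankel (k : nat) (x y : R) :
  0 <= x ^+ 2 * cov k.*2 + 2 * x * y * cov k.*2.+1 + y ^+ 2 * cov k.*2.+2.
Proof.
pose u N i := bounded_cov (truncation N) i.
have cu i : u N i @[N --> \oo] --> cov i.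
  exact: (@bounded_cov_cvg 0 i).
have H : x ^+ 2 * u N k.*2 + 2 * x * y * u N k.*2.+1 + y ^+ 2 * u N k.*2.+2
    @[N --> \oo] -->
    x ^+ 2 * cov k.*2 + 2 * x * y * cov k.*2.+1 + y ^+ 2 * cov k.*2.+2.
  by apply: cvgD; [apply: cvgD|]; apply: cvgM; do ?exact: cvg_cst; exact: cu.
rewrite -(cvg_lim _ H)//; apply: limr_ge; first exact: cvgP H.
apply: nearW => N; apply: bounded_cov_hankel => //; exact: bounded_truncation.
Qed.

(** Used with [a = -1] to bound every covariance by [cov 0], and with [a = 1] to show that
    consecutive summands cancel. *)
Lemma cov_sqr_add (a : R) (m : int) (k : nat) :
  \int[P]_x (g (Y m x) + a * g (Y (m + k%:Z) x)) ^+ 2 =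
  (1 + a ^+ 2) * cov 0 + 2 * a * cov k.
Proof.
rewrite (Lfun2_sqr_linear a (chain_Lfun2 m) (chain_Lfun2 (m + k%:Z))) /=.
have c0 n : \int[P]_x (g (Y n x) * g (Y n x)) = cov 0.
  by rewrite -(cov_lag n) addr0.
by rewrite !c0 cov_lag; ring.
Qed.

Lemma cov_le (k : nat) : cov k <= cov 0.
Proof.
have := cov_sqr_add (-1) 0 k.
set I := \int[P]_x _; have : 0 <= I by apply: Rintegral_ge0 => x _; exact: sqr_ge0.
lra.
Qed.

Lemma cov_even_ge0 (k : nat) : 0 <= cov k.*2.
Proof. by have := cov_hankel k 1 0; lra. Qed.

Lemma cov_pair_ge0 (k : nat) : 0 <= cov k.*2 + 2 * cov k.*2.+1 + cov k.*2.+2.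
Proof. by have := cov_hankel k 1 1; lra. Qed.

(* The nonnegative quadratic form of [cov_hankel] vanishes at (1, 1), hence so
   does its derivative. *)
Lemma cov_pair_eq0 : cov 0 + 2 * cov 1 + cov 2 = 0 -> cov 0 + cov 1 = 0.
Proof.
move=> E; set u := cov 0 + cov 1; have c0 : 0 <= cov 0 := cov_even_ge0 0.
have c1 : 0 < cov 0 + 1 by lra.
(* At (1 + t, 1) the form equals [t * (2 * u + t * cov 0)], which for this [t] is
   [- t ^+ 2 * (cov 0 + 2)]; nonnegativity forces [t = 0]. The [+ 1] keeps the denominator positive
   when [cov 0] vanishes. *)
pose t := - u / (cov 0 + 1).
have := cov_hankel 0 (1 + t) 1; rewrite /=.
have -> : (1 + t) ^+ 2 * cov 0 + 2 * (1 + t) * 1 * cov 1 + 1 ^+ 2 * cov 2 =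
  (cov 0 + 2 * cov 1 + cov 2) + t * (2 * u + t * cov 0).
  by rewrite /u; ring.
rewrite E add0r => H.
have ut : u = - t * (cov 0 + 1) by rewrite /t; field; rewrite gt_eqF.
have t0 : t ^+ 2 * (cov 0 + 2) <= 0 by move: H; rewrite ut; nra.
have : t = 0.
  apply/eqP; rewrite -sqrf_eq0 eq_le sqr_ge0 andbT.
  by rewrite -(pmulr_lle0 _ (_ : 0 < cov 0 + 2))//; lra.
by move=> t00; rewrite ut t00 oppr0 mul0r.
Qed.

(** * Partial sums, their variances and the degenerate case *)

Lemma summand_Lfun2 (k : nat) : summand Y g k \in Lfun P 2%:E.
Proof. exact: chain_Lfun2. Qed.

Lemma partial_sum0 : partial_sum Y g 0 = fun=> 0.
Proof. by apply/funext => x; rewrite /partial_sum big_geq. Qed.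

Lemma partial_sumS (n : nat) :
  partial_sum Y g n.+1 = partial_sum Y g n \+ summand Y g n.+1.
Proof. by apply/funext => x; rewrite /partial_sum big_nat_recr. Qed.

Lemma partial_sum_Lfun2 (n : nat) : partial_sum Y g n \in Lfun P 2%:E.
Proof.
elim: n => [|n IH]; first by rewrite partial_sum0; exact: Lfun_cst.
rewrite partial_sumS; exact: Lfun2D (summand_Lfun2 _).
Qed.

Lemma Rintegral_partial_sum_mul (n : nat) (h : Omega -> R) :
  h \in Lfun P 2%:E ->
  \int[P]_x (partial_sum Y g n x * h x) =
  \sum_(1 <= k < n.+1) \int[P]_x (summand Y g k x * h x).
Proof.
move=> Lh; elim: n => [|n IH].
  rewrite big_geq// partial_sum0.
  by under eq_Rintegral do rewrite mul0r; rewrite Rintegral_cst// mul0r.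
rewrite big_nat_recr//= -IH partial_sumS.
under eq_Rintegral do rewrite /= mulrDl.
rewrite RintegralD//.
  exact: Lfun2_integrable_mul (partial_sum_Lfun2 n) Lh.
exact: Lfun2_integrable_mul (summand_Lfun2 n.+1) Lh.
Qed.

Definition variance_sum (n : nat) : R := \int[P]_x (partial_sum Y g n x ^+ 2).

Lemma variance_sum0 : variance_sum 0 = 0.
Proof.
rewrite /variance_sum partial_sum0.
by under eq_Rintegral do rewrite expr0n/=; rewrite Rintegral_cst// mul0r.
Qed.

Lemma variance_sumS (n : nat) :
  variance_sum n.+1 = variance_sum n + cov 0 + 2 * \sum_(1 <= k < n.+1) cov k.
Proof.
have E := Lfun2_sqr_linear 1 (partial_sum_Lfun2 n) (summand_Lfun2 n.+1).
rewrite /variance_sum partial_sumS.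
under eq_Rintegral do rewrite /= -[summand _ _ _ _]mul1r.
rewrite E (@Rintegral_partial_sum_mul n (summand Y g n.+1)) ?summand_Lfun2//.
rewrite mulr1 expr1n mul1r.
have -> : \int[P]_x (summand Y g n.+1 x * summand Y g n.+1 x) = cov 0.
  by rewrite -(cov_lag n.+1) addr0.
have -> : \sum_(1 <= k < n.+1) \int[P]_x (summand Y g k x * summand Y g n.+1 x) =
          \sum_(1 <= k < n.+1) cov k.
  (* Reversing the sum turns the index into n+1-k, whose lag to n+1 is [k]. *)
  rewrite big_nat_rev/= !big_nat; apply: eq_bigr => k /andP[k1 kn].
  rewrite -(cov_lag (1 + n.+1 - k.+1)%N).
  by rewrite -PoszD add1n subSS subnK// ltnW.
by rewrite -addrA [2 * _ + _]addrC addrA.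
Qed.

Lemma sigma2E (n : nat) : sigma2 Y g n = (variance_sum n)%:E.
Proof.
rewrite /sigma2 unlock /variance_sum /Rintegral fineK//.
apply: integrable_fin_num => //.
exact: Lfun2_integrable_sqr (partial_sum_Lfun2 n).
Qed.

Lemma ellE (n : nat) : ell Y g n = (variance_sum n / n%:R)%:E.
Proof. by rewrite /ell sigma2E. Qed.

(** The second moment of the sum of the two summands is [2 * (cov 0 + cov 1)], so this sum vanishes
    almost surely. *)
Lemma summandS_ae (k : nat) : cov 0 + cov 1 = 0 ->
  \forall x \ae P, summand Y g k.+1 x = - summand Y g k x.
Proof.
move=> E; have := cov_sqr_add 1 k%:Z 1; rewrite expr1n mulr1 -mulrDr E mulr0 => I0.
have L : summand Y g k \+ summand Y g k.+1 \in Lfun P 2%:E.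
  by apply: Lfun2D; exact: summand_Lfun2.
have I := Lfun2_integrable_sqr L.
have : (\int[P]_x `|((summand Y g k x + summand Y g k.+1 x) ^+ 2)%:E| = 0)%E.
  transitivity (\int[P]_x ((summand Y g k x + summand Y g k.+1 x) ^+ 2)%:E)%E.
    by apply: eq_integral => x _; rewrite gee0_abs// lee_fin sqr_ge0.
  rewrite -[LHS]fineK; last exact: integrable_fin_num I.
  congr EFin; rewrite -[RHS]I0; apply: eq_Rintegral => x _.
  by rewrite mul1r -PoszD addn1.
move=> /(ae_eq_integral_abs P measurableT (measurable_int _ I)).1.
apply: filterS => x /(_ Logic.I) /= [] /eqP.
by rewrite sqrf_eq0 addrC addr_eq0 => /eqP.
Qed.

(** The alternating sign of the last summand is carried along because the induction step for the sum
    relies on it. *)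
Lemma partial_sum_ae (n : nat) : cov 0 + cov 1 = 0 ->
  \forall x \ae P,
    partial_sum Y g n.+1 x = 2^-1 * (1 + (-1) ^+ n) * summand Y g 1 x /\
    summand Y g n.+1 x = (-1) ^+ n * summand Y g 1 x.
Proof.
move=> E; elim: n => [|n IH].
  apply: aeW => x; rewrite partial_sumS partial_sum0/= expr0 mul1r add0r.
  by split => //; rewrite mulVf ?mul1r.
have H := summandS_ae n.+1 E.
apply: filterS2 IH H => x [S1 X1] X2; rewrite partial_sumS/= S1 X2 X1 exprS.
by split; field.
Qed.

Lemma ell_cvg : (limn_einf (ell Y g) < +oo)%E ->
  exists2 kappa : R, 0 <= kappa & ell Y g n @[n --> \oo] --> kappa%:E.
Proof.
move=> ell_fin.
have le_ell j : ((pair_sum cov j)%:E <= limn_einf (ell Y g))%E.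
  rewrite (funext ellE); apply: pair_sum_le_limn_einf;
    [exact: cov_even_ge0|exact: cov_le|exact: cov_pair_ge0|exact: variance_sum0|
     exact: variance_sumS].
have B0 : (0 <= limn_einf (ell Y g))%E.
  by apply: le_trans (le_ell 0%N); rewrite lee_fin pair_sum_ge0//; exact: cov_pair_ge0.
have [kappa kappa0 Vk] : exists2 k : R, 0 <= k &
    variance_sum n / n%:R @[n --> \oo] --> k.
  apply: (@double_sum_cvg _ cov _ cov_even_ge0 cov_le cov_pair_ge0 variance_sum0
    variance_sumS (fine (limn_einf (ell Y g)))) => j.
  by rewrite -lee_fin fineK ?ge0_fin_numE.
exists kappa => //; rewrite (funext ellE).
exact: cvg_EFin (nearW _ _) Vk.
Qed.

(** [pair_sum cov 0] is squeezed between 0 and the liminf, which supplies the hypothesis of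
    [cov_pair_eq0]. *)
Lemma ell_einf0 : limn_einf (ell Y g) = 0%E -> cov 0 + cov 1 = 0.
Proof.
move=> ell0; apply: cov_pair_eq0; apply/eqP.
rewrite eq_le (cov_pair_ge0 0) andbT.
have := @pair_sum_le_limn_einf _ cov _ cov_even_ge0 cov_le cov_pair_ge0
  variance_sum0 variance_sumS 0.
rewrite -(funext ellE) ell0 lee_fin.
by rewrite /pair_sum big_nat1.
Qed.

End ReversibleChain.

Theorem proposition1 (R : realType) (d : measure_display)
    (Omega : measurableType d) (P : probability Omega R)
    (W : ptopologicalType) (hW : polish R W)
    (Y : int -> {RV P >-> borel W})
    (Q : R.-pker (borel W) ~> (borel W)) (pi : probability (borel W) R)
    (hstat : stationary Y) (hmarkov : markov_chain Y Q)
    (hmarg : marginal Y pi) (hrev : reversible Q pi)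
    (g : borel W -> R) (hg : L20 pi g) :
  ((limn_einf (ell Y g) < +oo)%E ->
     exists2 kappa : R, 0 <= kappa & ell Y g n @[n --> \oo] --> kappa%:E) /\
  ((limn_einf (ell Y g) = 0)%E ->
     forall n : nat, (1 <= n)%N ->
       \forall w \ae P,
         partial_sum Y g n w =
         2^-1 * (1 + (-1) ^+ (n - 1)) * summand Y g 1 w).
Proof.
have Lg := hg.1; split; first exact (ell_cvg hmarkov hmarg hrev Lg).
move=> /(ell_einf0 hmarkov hmarg hrev Lg) c01 [//|n] _.
have := partial_sum_ae hmarkov hmarg Lg n c01.
by apply: filterS => w [Sn _]; rewrite Sn subSS subn0.
Qed.
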